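(* Let $G$ be a minimally $2$-connected graph of order $n\geq 5$, and let $\alpha\in[\frac{1}{2},1)$. Then $$\rho_{\alpha}(G)\leq\rho_{\alpha}(K_{2,n-2}),$$ with equality if and only if $G\cong K_{2,n-2}$.
   Context: All graphs are finite, simple and undirected. The order of a graph is its number of vertices. For a graph $G$, let $A(G)$ be its adjacency matrix and $D(G)$ the diagonal matrix of its vertex degrees. For real $\alpha\in[0,1]$, define $A_\alpha(G)=\alpha D(G)+(1-\alpha)A(G)$; its largest eigenvalue is denoted $\rho_\alpha(G)$ (the $\alpha$-index, or $A_\alpha$-spectral radius, of $G$). A graph is $k$-connected if removing fewer than $k$ vertices always leaves the remaining graph connected. A graph is minimally $k$-connected if it is $k$-connected and deleting any arbitrarily chosen edge always leaves a graph that is not $k$-connected. $K_{s,t}$ denotes the complete bipartite graph with parts of sizes $s$ and $t$. *)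

(* Defs.v *)
From mathcomp Require Import all_boot all_order all_algebra.
From mathcomp Require Import classical_sets reals.

Set Implicit Arguments.
Unset Strict Implicit.
Unset Printing Implicit Defensive.

Import Order.TTheory GRing.Theory Num.Theory.
Local Open Scope ring_scope.

Record sgraph := SGraph {
  vertex :> finType;
  adj : rel vertex;
  adj_sym : symmetric adj;
  adj_irr : irreflexive adj
}.

Definition graph_iso (G H : sgraph) : Prop :=
  exists2 f : G -> H, bijective f & forall x y, adj (f x) (f y) = adj x y.

Section Deletion.
Variable G : sgraph.

Section Vertices.
Variable S : {set G}.

Definition delv_adj : rel {x : G | x \notin S} :=
  fun x y => adj (val x) (val y).

Lemma delv_adj_sym : symmetric delv_adj.
Proof. by move=> x y; rewrite /delv_adj adj_sym. Qed.

Lemma delv_adj_irr : irreflexive delv_adj.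
Proof. by move=> x; rewrite /delv_adj adj_irr. Qed.

Definition del_vertices : sgraph := SGraph delv_adj_sym delv_adj_irr.

End Vertices.

Section Edge.
Variables u v : G.

Definition dele_adj : rel G :=
  fun x y => adj x y && ([set x; y] != [set u; v]).

Lemma dele_adj_sym : symmetric dele_adj.
Proof. by move=> x y; rewrite /dele_adj adj_sym finset.setUC. Qed.

Lemma dele_adj_irr : irreflexive dele_adj.
Proof. by move=> x; rewrite /dele_adj adj_irr. Qed.

Definition del_edge : sgraph := SGraph dele_adj_sym dele_adj_irr.

End Edge.
End Deletion.

Definition graph_connected (G : sgraph) : Prop :=
  forall x y : G, connect (@adj G) x y.

(* Many authors also require more than k vertices.  For k = 2 this only
   affects graphs with at most two vertices. *)
Definition k_connected (k : nat) (G : sgraph) : Prop :=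
  forall S : {set G}, (#|S| < k)%N -> graph_connected (del_vertices S).

Definition minimally_k_connected (k : nat) (G : sgraph) : Prop :=
  k_connected k G /\
  forall u v : G, adj u v -> ~ k_connected k (del_edge u v).

Section CompleteBipartite.
Variables s t : nat.

Definition Kst_adj : rel ('I_s + 'I_t)%type := fun x y =>
  match x, y with
  | inl _, inr _ | inr _, inl _ => true
  | _, _ => false
  end.

Lemma Kst_adj_sym : symmetric Kst_adj. Proof. by case=> ? []. Qed.

Lemma Kst_adj_irr : irreflexive Kst_adj. Proof. by case. Qed.

Definition complete_bipartite : sgraph := SGraph Kst_adj_sym Kst_adj_irr.

End CompleteBipartite.

Section AlphaIndex.
Variables (R : realType) (alpha : R) (G : sgraph).

Definition degree (x : G) : nat := #|[set y | adj x y]|.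

Definition adjacency_mx : 'M[R]_#|G| :=
  \matrix_(i, j) (adj (enum_val i) (enum_val j))%:R.

Definition degree_mx : 'M[R]_#|G| :=
  diag_mx (\row_i (degree (enum_val i))%:R).

Definition A_alpha : 'M[R]_#|G| :=
  alpha *: degree_mx + (1 - alpha) *: adjacency_mx.

(* The spectrum is finite, and nonempty when G has a vertex since A_alpha is
   real symmetric, so the supremum is then the largest eigenvalue. *)
Definition alpha_index : R := sup [set r : R | eigenvalue A_alpha r]%classic.

End AlphaIndex.

(* Main.v *)
(* Let [rho >= rho'] be the eigenvalues of the quotient matrix of [K_{2,n-2}]. The row sum of
   [(A_alpha G - rho)(A_alpha G - rho')] at a vertex [v] of degree [d], whose neighbours have
   degree sum [S], is
     (2 alpha - 1)(d - 2)(d - (n - 2)) + (1 - alpha)(d^2 + S - n d).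
   A minimally 2-connected graph is triangle-free with [2 <= d <= n - 2], so the neighbours of [v]
   send all their edges outside [N(v)], [S <= d (n - d)], and the row sum is nonpositive. Hence the
   vector [z = deg - rho'], positive because [rho' < 2], satisfies [A_alpha z <= rho z], which
   bounds the spectrum by [rho]. In case of equality some row sum vanishes; then [S = d (n - d)]
   makes [G] complete bipartite with parts [N(v)] and its complement, and minimality forces one
   part to have size 2. *)

Require Import Defs.
From mathcomp Require Import boolp classical_sets.
From mathcomp Require Import all_boot all_order all_algebra.
From mathcomp Require Import reals.
From mathcomp Require Import ring lra zify.

Set Implicit Arguments.
Unset Strict Implicit.
Unset Printing Implicit Defensive.

Import Order.TTheory GRing.Theory Num.Theory.
Local Open Scope ring_scope.

(** * Connectivity after deleting vertices or an edge *)

(** Since [w] is not a cut vertex, [X] cannot be closed under adjacency in the graph without [w],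
    where [z] is still reachable from [x]. *)
Lemma k_connected2_exit (G : sgraph) (w x z : G) (X : {set G}) :
  k_connected 2 G -> w \notin X -> x \in X -> z \notin X -> z != w ->
  exists a b : G, [/\ a \in X, b \notin X, b != w & adj a b].
Proof.
move=> Gconn wX xX zX zw; apply: contrapT => noexit.
have xS : x \notin [set w] by rewrite inE; apply: contraNneq wX => <-.
have zS : z \notin [set w] by rewrite inE.
have S2 : (#|[set w]| < 2)%N by rewrite cards1.
have := Gconn _ S2 (exist _ x xS) (exist _ z zS) => cxz.
have cl : closed (@adj (del_vertices [set w])) [pred y | val y \in X].
  apply: intro_closed; first exact/sym_connect_sym/adj_sym.
  move=> a b /= ab; rewrite !inE => aX; apply: contraT => bX; case: noexit.
  exists (val a), (val b); split=> //.
  by have := valP b; rewrite inE.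
by have := closed_connect cl cxz; rewrite !inE /= xX (negPf zX).
Qed.

(* [C] is the component of [u] once the vertices [S] and the edge [uv] are deleted, for an [S]
   that witnesses that deleting [uv] destroys k-connectedness. *)
Lemma minimally_k_connected_cut (k : nat) (G : sgraph) (u v : G) :
  minimally_k_connected k G -> adj u v ->
  exists S C : {set G}, [/\ (#|S| < k)%N, u \in C, v \notin S :|: C,
    forall x, x \in C -> x \notin S &
    forall x y, x \in C -> adj x y -> y \notin S ->
      (x != u) || (y != v) -> y \in C].
Proof.
move=> [Gconn Gmin] uv; apply: contrapT => nocut; apply: (Gmin u v uv) => S Sk.
pose H := del_vertices (G := del_edge u v) S.
(* If [u] and [v] were separated in [H], the component of [u] would be the cut assumed not to
   exist. *)
have key (u' v' : H) : val u' = u -> val v' = v -> connect (@adj H) u' v'.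
  move=> u'u v'v; apply: contraT => ncon; case: nocut.
  pose C : {set G} := val @: [set z : H | connect (@adj H) u' z].
  have vC : v \notin C.
    rewrite -v'v; apply/imsetP=> -[z]; rewrite inE => cz /val_inj zv.
    by rewrite zv cz in ncon.
  exists S, C; split=> //.
  - by rewrite -u'u imset_f // inE connect0.
  - by rewrite !inE negb_or vC -v'v (valP v').
  - by move=> _ /imsetP[z _ ->]; exact: (valP z).
  - move=> x y xC + yS ne.
    case/imsetP: (xC) => z + xz; rewrite xz inE => cz zy.
    apply/imsetP; exists (exist _ y yS) => //; rewrite inE.
    apply: connect_trans cz (connect1 _); rewrite /= /delv_adj /= /dele_adj zy /=.
    rewrite -xz; apply: contraNneq vC => e.
    have : x \in [set u; v] by rewrite -e set21.
    have : y \in [set u; v] by rewrite -e set22.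
    rewrite !inE => /orP[/eqP yu|/eqP yv] /orP[/eqP xu|/eqP xv].
    + by rewrite -[v](_ : x = v) //; apply/esym/eqP; have := set22 u v; rewrite -e xu yu !inE orbb.
    + by rewrite -xv.
    + by rewrite xu yv !eqxx in ne.
    + by rewrite -xv.
(* Every edge of [G] outside [S] survives in [H] except [uv], which [key] replaces by a walk. *)
move=> a b; have := Gconn S Sk a b; apply: connect_sub => x y xy.
have [xyuv|ne] := eqVneq [set val x; val y] [set u; v]; last first.
  by apply: connect1; rewrite /= /delv_adj /= /dele_adj; apply/andP.
have xne : val x != val y.
  by apply: contraTneq xy => e; rewrite /= /delv_adj e adj_irr.
have : val x \in [set u; v] by rewrite -xyuv set21.
have : val y \in [set u; v] by rewrite -xyuv set22.
rewrite !inE => /orP[/eqP yu|/eqP yv] /orP[/eqP xu|/eqP xv].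
- by rewrite xu yu eqxx in xne.
- by rewrite (sym_connect_sym (@adj_sym H)); exact: key.
- exact: key.
- by rewrite xv yv eqxx in xne.
Qed.

Lemma card_lt2_eq (T : finType) (S : {set T}) (x y : T) :
  (#|S| < 2)%N -> x \in S -> y \in S -> x = y.
Proof. by rewrite ltnS => /card_le1_eqP h xS yS; exact: h. Qed.

Lemma adj_neq (G : sgraph) (x y : G) : adj x y -> x != y.
Proof. by apply: contraTneq => ->; rewrite adj_irr. Qed.

Lemma card_ge3_other (T : finType) (x y : T) :
  (2 < #|T|)%N -> exists z : T, z != x /\ z != y.
Proof.
move=> T3; have /card_gt0P[z] : (0 < #|~: [set x; y]|)%N.
  by rewrite -(ltn_add2l #|[set x; y]|) cardsC addn0 cards2 (leq_ltn_trans _ T3) // ltnS leq_b1.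
by rewrite !inE negb_or => /andP[zx zy]; exists z.
Qed.

(** * Structure of minimally 2-connected graphs *)

Section MinimallyTwoConnected.
Variable G : sgraph.
Hypothesis Gmin : minimally_k_connected 2 G.
Hypothesis G4 : (3 < #|G|)%N.

(** The path [u], [t], [v] bypasses the edge [uv], so the at most one vertex deleted along with [uv]
    must be [t]. *)
Lemma triangle_cut (u v t : G) : adj u v -> adj u t -> adj v t ->
  exists C : {set G}, [/\ u \in C, v \notin C, t \notin C &
    forall x y, x \in C -> adj x y -> y != t -> (x != u) || (y != v) -> y \in C].
Proof.
move=> uv ut vt.
have [S [C [S2 uC]]] := minimally_k_connected_cut Gmin uv.
rewrite inE negb_or => /andP[vS vC] CS Ccl.
have [uNt vNt] := (adj_neq ut, adj_neq vt).
have tS : t \in S.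
  apply: contraNT vC => tS; have tC : t \in C.
    by apply: (Ccl u) => //; rewrite orbC eq_sym vNt.
  by apply: (Ccl t) => //; rewrite ?(adj_sym t) // eq_sym uNt.
exists C; split=> // [|x y xC xy yt]; first by apply: contraL tS; exact: CS.
by apply: (Ccl x y xC xy); apply: contra_neqN yt => yS; exact: (card_lt2_eq S2).
Qed.

(* The component of [u] avoiding [t] and the edge [uv] and the component of [u] avoiding [v] and the
   edge [ut] can only meet in [u], since an edge leaving the rest of the intersection would end in
   [u], which is not a cut vertex. *)
Lemma triangle_deg2 (u v t y : G) : adj u v -> adj u t -> adj v t ->
  adj u y -> (y == v) || (y == t).
Proof.
move=> uv ut vt uy; apply: contraT; rewrite negb_or => /andP[yv yt].
have [C [uC vC tC Ccl]] := triangle_cut uv ut vt.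
have tv : adj t v by rewrite adj_sym.
have [D [uD tD vD Dcl]] := triangle_cut ut uv tv.
have yX : y \in (C :&: D) :\ u.
  rewrite !inE eq_sym adj_neq //= (Ccl u) ?yv ?orbT // (Dcl u) ?yt ?orbT //.
have uX : u \notin (C :&: D) :\ u by rewrite !inE eqxx.
have tX : t \notin (C :&: D) :\ u by rewrite !inE (negPf tC) andbF.
have tu : t != u by rewrite eq_sym adj_neq.
have [a [b [+ + bu ab]]] := k_connected2_exit Gmin.1 uX yX tX tu.
rewrite !inE bu /= negb_and => /and3P[au aC aD] /orP[bC|bD].
(* From a vertex of [C] other than [u], an edge can leave [C] only to [t]; but [D] avoids [v] and
   the edge [ut] only, so it would contain [t]. *)
- have bt : b = t by apply: contraNeq bC => bt; apply: (Ccl a); rewrite ?au.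
  by case/negP: tD; rewrite -bt; apply: (Dcl a); rewrite ?au // bt adj_neq.
- have bv : b = v by apply: contraNeq bD => bv; apply: (Dcl a); rewrite ?au.
  by case/negP: vC; rewrite -bv; apply: (Ccl a); rewrite ?au // bv adj_neq.
Qed.

(** By [triangle_deg2], [u] and [v] have no neighbours outside the triangle, so [t] would separate
    them from a fourth vertex. *)
Lemma min2conn_triangle_free (u v t : G) : adj u v -> adj u t -> ~~ adj v t.
Proof.
move=> uv ut; apply/negP => vt.
have [[vu tu] tv] := (adj_sym v u, adj_sym t u, adj_sym t v).
rewrite uv in vu; rewrite ut in tu; rewrite vt in tv.
have tX : t \notin [set u; v] by rewrite !inE negb_or adj_neq // adj_neq.
have /card_gt0P[z] : (0 < #|~: [set u; v; t]|)%N.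
  rewrite -(ltn_add2l #|[set u; v; t]|) cardsC addn0; apply: leq_ltn_trans G4.
  by rewrite setUC cardsU1 cards2; case: (t \notin _); case: (u != v).
rewrite !inE !negb_or => /andP[/andP[zu zv] zt].
have uX : u \in [set u; v] by rewrite set21.
have zX : z \notin [set u; v] by rewrite !inE negb_or zu zv.
have [a [b [+ + bt ab]]] := k_connected2_exit Gmin.1 tX uX zX zt.
rewrite !inE => /orP[/eqP au|/eqP av]; rewrite negb_or => /andP[bu bv].
- have := triangle_deg2 uv ut vt; move/(_ b); rewrite -au => /(_ ab).
  by rewrite (negPf bt) (negPf bv).
- have := triangle_deg2 vu vt ut; move/(_ b); rewrite -av => /(_ ab).
  by rewrite (negPf bt) (negPf bu).
Qed.

(** Deleting the only neighbour [w] of [v], or any other vertex if [v] has none, would isolate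
    [v]. *)
Lemma degree_ge2 (v : G) : (1 < degree v)%N.
Proof.
rewrite ltnNge; apply/negP => deg1.
have [w [wv wN]] : exists w, w != v /\ forall y, adj v y -> y = w.
  have [N0|[w]] := set_0Vmem [set y | adj v y].
    have [w [wv _]] : exists w, w != v /\ w != v by apply: card_ge3_other; exact: ltnW.
    by exists w; split=> // y vy; have := in_set0 y; rewrite -N0 inE vy.
  rewrite inE => vw; exists w; split=> [|y vy]; first by rewrite eq_sym adj_neq.
  by apply: (card_lt2_eq (S := [set y | adj v y])); rewrite ?inE // ltnS.
have [z [zv zw]] : exists z, z != v /\ z != w by apply: card_ge3_other; exact: ltnW.
have wX : w \notin [set v] by rewrite inE.
have zX : z \notin [set v] by rewrite inE.
have [a [b [/set1P -> _ bw /wN e]]] := k_connected2_exit Gmin.1 wX (set11 v) zX zw.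
by rewrite e eqxx in bw.
Qed.

(* If both sides have a third vertex then [u v' u' v] avoids any one further deleted vertex. *)
Lemma complete_bipartite_min2conn (A : {set G}) :
  (1 < #|A|)%N -> (1 < #|~: A|)%N ->
  (forall x y : G, adj x y = (x \in A) (+) (y \in A)) ->
  exists B : {set G}, [/\ #|B| = 2%N, #|~: B| = (#|G| - 2)%N &
    forall x y : G, adj x y = (x \in B) (+) (y \in B)].
Proof.
move=> A2 cA2 Aadj.
have [A3|] := boolP (2 < #|A|)%N; last first.
  rewrite -leqNgt => A2'; have A2e : #|A| = 2%N by apply/eqP; rewrite eqn_leq A2' A2.
  by exists A; split; rewrite // -(cardsC A) A2e addKn.
have [cA3|] := boolP (2 < #|~: A|)%N; last first.
  rewrite -leqNgt => A2'; have A2e : #|~: A| = 2%N by apply/eqP; rewrite eqn_leq A2' cA2.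
  exists (~: A); split; rewrite ?setCK //; first by rewrite -(cardsC A) A2e addnK.
  by move=> x y; rewrite Aadj !inE addNb addbN negbK.
have /card_gt0P[u uA] : (0 < #|A|)%N by apply: leq_trans A2.
have /card_gt0P[v] : (0 < #|~: A|)%N by apply: leq_trans cA2.
rewrite inE => vA.
have uv : adj u v by rewrite Aadj uA (negPf vA).
have [S [C [S2 uC]]] := minimally_k_connected_cut Gmin uv.
rewrite inE negb_or => /andP[vS vC] CS Ccl.
have avoid (B : {set G}) x : (2 < #|B|)%N -> exists y, [/\ y \in B, y != x & y \notin S].
  move=> B3; have /card_gt0P[y] : (0 < #|B :\: (x |: S)|)%N.
    rewrite cardsD subn_gt0; apply: leq_ltn_trans (subset_leq_card (subsetIr _ _)) _.
    by apply: leq_ltn_trans B3; rewrite cardsU1; case: (_ \notin _); [exact: S2|exact: ltnW].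
  by rewrite !inE negb_or => /andP[/andP[yx yS] yB]; exists y.
have [u' [u'A u'u u'S]] := avoid _ u A3.
have [v' [+ v'v v'S]] := avoid _ v cA3; rewrite inE => v'A.
have v'C : v' \in C by apply: (Ccl u); rewrite ?v'v ?orbT // Aadj uA (negPf v'A).
have v'u : v' != u by apply: contraNneq v'A => ->.
have u'C : u' \in C by apply: (Ccl v'); rewrite ?v'u // Aadj u'A (negPf v'A).
by case/negP: vC; apply: (Ccl u'); rewrite ?u'u // Aadj u'A (negPf vA).
Qed.

End MinimallyTwoConnected.

(** * The operator [A_alpha] and Perron-type bounds on its spectrum *)

Section AlphaAction.
Variables (R : realType) (alpha : R).

(** [A_alpha] as an operator on functions of the vertices, free of the enumeration by ordinals. *)
Definition alpha_action (G : sgraph) (x : G -> R) (v : G) : R :=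
  alpha * (degree v)%:R * x v + (1 - alpha) * \sum_(u | adj v u) x u.

Lemma A_alphaE (G : sgraph) (x : G -> R) (v : G) :
  ((\row_i x (enum_val i)) *m A_alpha alpha G) 0 (enum_rank v) =
  alpha_action x v.
Proof.
rewrite mxE /alpha_action.
under eq_bigr => i _ do rewrite !mxE mulrDr.
rewrite big_split /=; congr (_ + _).
  rewrite (bigD1 (enum_rank v)) //= big1 => [|i ne]; last first.
    by rewrite (negPf ne) mulr0n mulr0 mulr0.
  by rewrite eqxx mulr1n addr0 enum_rankK mulrC.
rewrite big_distrr [RHS]big_mkcond /= (reindex (@enum_rank G)) /=; last first.
  by exists enum_val => ? _; rewrite ?enum_rankK ?enum_valK.
apply: eq_bigr => u _; rewrite !enum_rankK adj_sym.
by case: ifP => _; rewrite ?mulr0 // mulr1 mulrC.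
Qed.

Lemma alpha_eigenvalueP (G : sgraph) (r : R) :
  eigenvalue (A_alpha alpha G) r <->
  exists x : G -> R, (exists v, x v != 0) /\
                     forall v, alpha_action x v = r * x v.
Proof.
split=> [/eigenvalueP[w wA w0]|[x [[v xv] xA]]].
  pose x v := w 0 (enum_rank v).
  have wE : w = \row_i x (enum_val i).
    by apply/rowP => i; rewrite mxE /x enum_valK.
  exists x; split=> [|v]; last by rewrite -A_alphaE -wE wA mxE.
  by have /rV0Pn[i wi] := w0; exists (enum_val i); rewrite /x enum_valK.
apply/eigenvalueP; exists (\row_i x (enum_val i)).
  by apply/rowP => i; rewrite -(enum_valK i) A_alphaE !mxE enum_rankK.
by apply/rV0Pn; exists (enum_rank v); rewrite mxE enum_rankK.
Qed.

Lemma alpha_action_sym (G : sgraph) (x y : G -> R) :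
  \sum_v alpha_action x v * y v = \sum_v x v * alpha_action y v.
Proof.
rewrite /alpha_action.
under eq_bigr => v _ do rewrite mulrDl.
under [RHS]eq_bigr => v _ do rewrite mulrDr.
rewrite !big_split /=; congr (_ + _); first by apply: eq_bigr => v _; ring.
under eq_bigr => v _ do rewrite -mulrA mulr_suml.
under [RHS]eq_bigr => v _ do rewrite mulrCA mulr_sumr.
rewrite -!mulr_sumr; congr (_ * _).
under eq_bigr => v _ do rewrite big_mkcond.
rewrite exchange_big /=; apply: eq_bigr => v _.
by rewrite [RHS]big_mkcond; apply: eq_bigr => u _; rewrite adj_sym.
Qed.

Lemma graph_iso_alpha_index (G H : sgraph) :
  graph_iso G H -> alpha_index alpha G = alpha_index alpha H.
Proof.
move=> [f [g fK gK] fadj].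
have bf : bijective f by exists g.
have bg : bijective g by exists f.
have degf v : degree (f v) = degree v.
  rewrite /degree -(card_imset _ (bij_inj bf)); apply: eq_card => y.
  rewrite inE -[y]gK fadj; apply/idP/imsetP => [vy|[z + /(bij_inj bf) ->]].
    by exists (g y); rewrite ?inE.
  by rewrite inE.
have actf (x : H -> R) v : alpha_action (x \o f) v = alpha_action x (f v).
  rewrite /alpha_action degf /=; congr (_ + _ * _).
  by rewrite [RHS](reindex f) /=; [apply: eq_bigl => u; rewrite fadj|exact: onW_bij].
congr sup; apply/funext => r; apply/propext; split=> /alpha_eigenvalueP[x [[v xv] xA]];
  apply/alpha_eigenvalueP.
  exists (x \o g); split=> [|w]; first by exists (f v); rewrite /= fK.
  rewrite -[w]gK -actf /= fK -xA; congr alpha_action.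
  by apply/funext => u; rewrite /= fK.
exists (x \o f); split=> [|w]; first by exists (g v); rewrite /= gK.
by rewrite actf xA.
Qed.

Hypothesis alpha01 : 0 <= alpha <= 1.

(* Weighting [|x|] by [z] and moving the operator onto [z] by symmetry, [|r| <= q] for every
   eigenvalue [r]. *)
Lemma alpha_eigenvalue_le (G : sgraph) (z : G -> R) (q r : R) :
  (forall v, 0 < z v) -> (forall v, alpha_action z v <= q * z v) ->
  eigenvalue (A_alpha alpha G) r -> r <= q.
Proof.
move=> z0 zq /alpha_eigenvalueP[x [[w xw] xA]].
have /andP[a0 a1] := alpha01.
have xle v : r * `|x v| <= alpha_action (fun u => `|x u|) v.
  apply: (le_trans (ler_norm _)); rewrite normrM normr_id -normrM -xA.
  apply: (le_trans (ler_normD _ _)); rewrite !normrM.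
  rewrite (ger0_norm a0) (ger0_norm (ler0n _ _)) lerD2l ger0_norm ?subr_ge0 //.
  by rewrite ler_wpM2l ?subr_ge0 // ler_norm_sum.
have S0 : 0 < \sum_v `|x v| * z v.
  rewrite (bigD1 w) //= ltr_pwDl ?mulr_gt0 ?normr_gt0 //.
  by apply: sumr_ge0 => v _; rewrite mulr_ge0 // ltW.
rewrite -(ler_pM2r S0) !mulr_sumr.
apply: (@le_trans _ _ (\sum_v alpha_action (fun u => `|x u|) v * z v)).
  by apply: ler_sum => v _; rewrite mulrA ler_wpM2r // ltW.
rewrite alpha_action_sym; apply: ler_sum => v _.
by rewrite mulrCA ler_wpM2l.
Qed.

Lemma alpha_index_le (G : sgraph) (z : G -> R) (q : R) : 0 <= q ->
  (forall v, 0 < z v) -> (forall v, alpha_action z v <= q * z v) ->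
  alpha_index alpha G <= q.
Proof.
move=> q0 z0 zq; have [E0|] := pselect ([set r | eigenvalue (A_alpha alpha G) r] !=set0)%classic.
  by apply: ge_sup => // r; exact: alpha_eigenvalue_le.
(* The supremum of an empty spectrum is 0 by convention, hence the use of [0 <= q]. *)
by move/nonemptyPn => E0; rewrite /alpha_index E0 sup0.
Qed.

(** A positive eigenvector serves as its own weight in [alpha_eigenvalue_le], so its eigenvalue is
    the largest. *)
Lemma alpha_index_eq (G : sgraph) (z : G -> R) (q : R) : (0 < #|G|)%N ->
  (forall v, 0 < z v) -> (forall v, alpha_action z v = q * z v) ->
  alpha_index alpha G = q.
Proof.
move=> /card_gt0P[w _] z0 zq.
have qe : eigenvalue (A_alpha alpha G) q.
  by apply/alpha_eigenvalueP; exists z; split=> //; exists w; rewrite gt_eqF.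
have ubq : ubound [set r | eigenvalue (A_alpha alpha G) r]%classic q.
  by move=> r; apply: alpha_eigenvalue_le z0 _ => v; rewrite zq.
apply/le_anti/andP; split; first by apply: ge_sup => //; exists q.
by apply: ub_le_sup => //; exists q.
Qed.

(** The largest Collatz-Wielandt quotient [alpha_action z v / z v] also bounds the index, so it
    cannot be smaller than [q]. *)
Lemma alpha_index_eq_witness (G : sgraph) (z : G -> R) (q : R) : (0 < #|G|)%N ->
  (forall v, 0 < z v) -> (forall v, alpha_action z v <= q * z v) ->
  alpha_index alpha G = q -> exists v, alpha_action z v = q * z v.
Proof.
move=> /card_gt0P[w _] z0 zq qE.
have /andP[a0 a1] := alpha01.
pose F v := alpha_action z v / z v.
have [v _ vmax] : exists2 v, true & forall u, F u <= F v.
  by case: (arg_maxP F (i0 := w) (P := xpredT)) => // v _ vmax; exists v => // u; exact: vmax.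
have FE u : alpha_action z u = F u * z u by rewrite divfK ?gt_eqF.
have F0 : 0 <= F v.
  rewrite /F /alpha_action divr_ge0 ?(ltW (z0 _)) // addr_ge0 // ?mulr_ge0 ?subr_ge0 //.
    exact: ltW.
  by apply: sumr_ge0 => u _; exact: ltW.
exists v; apply/le_anti; rewrite zq /= [leRHS]FE ler_pM2r // -qE.
by apply: (alpha_index_le F0 z0) => u; rewrite FE ler_pM2r.
Qed.

End AlphaAction.

(** * Recognising complete bipartite graphs and their degrees *)

Lemma complete_bipartite_iso (G : sgraph) (B : {set G}) :
  #|B| = 2%N -> #|~: B| = (#|G| - 2)%N ->
  (forall x y : G, adj x y = (x \in B) (+) (y \in B)) ->
  graph_iso G (complete_bipartite 2 (#|G| - 2)).
Proof.
move=> B2 cB adjB.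
pose g (s : 'I_2 + 'I_(#|G| - 2)) : G :=
  match s with
  | inl i => enum_val (cast_ord (esym B2) i)
  | inr j => enum_val (cast_ord (esym cB) j)
  end.
have gB s : (g s \in B) = if s is inl _ then true else false.
  case: s => i /=; first exact: enum_valP.
  by apply/negbTE; have := enum_valP (cast_ord (esym cB) i); rewrite inE.
have g_inj : injective g.
  move=> s1 s2 e; have := gB s1; rewrite e gB.
  by case: s1 s2 e => [i|i] [j|j] //= /enum_val_inj /cast_ord_inj ->.
have G2 : (2 <= #|G|)%N by rewrite -B2 max_card.
have [f gK fK] : bijective g.
  by apply: inj_card_bij => //; rewrite card_sum !card_ord subnKC.
exists f; first by exists g.
by move=> x y; rewrite -[in RHS](fK x) -[in RHS](fK y) adjB !gB; case: (f x) (f y) => ? [].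
Qed.

Lemma degree_complete_bipartite (s t : nat) (x : complete_bipartite s t) :
  degree x = if x is inl _ then t else s.
Proof.
rewrite /degree -sum1_card big_sumType /=.
by case: x => i; under eq_bigl => j do rewrite inE /=;
  under [X in (_ + X)%N]eq_bigl => j do rewrite inE /=;
  rewrite big_pred0_eq ?addn0 ?add0n sum1_card card_ord.
Qed.

(** * The quotient matrix and the row sum identity *)

Section RowSums.
Variables (R : realType) (alpha : R) (n : nat).
Hypothesis n5 : (5 <= n)%N.
Hypothesis halpha : 2^-1 <= alpha < 1.

(* The roots of the characteristic polynomial of the quotient matrix of [K_{2,n-2}]. *)
Lemma quotient_roots : exists rho rho' : R,
  [/\ rho + rho' = alpha * n%:R,
      rho * rho' = 2 * (n%:R - 2) * (2 * alpha - 1), 0 <= rho & rho' < 2].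
Proof.
have /andP[a2 a1] := halpha.
have n5R : (5 : R) <= n%:R by rewrite (ler_nat R 5 n).
pose s := alpha * n%:R; pose p := 2 * (n%:R - 2) * (2 * alpha - 1).
(* The characteristic polynomial is negative at 2, by [alpha < 1] and [n > 4], so 2 lies strictly
   between its roots. *)
have f2 : 4 - 2 * s + p < 0.
  rewrite (_ : _ + p = (1 - alpha) * (8 - 2 * n%:R)); last by rewrite /s /p; ring.
  by rewrite pmulr_rlt0 ?subr_gt0 //; lra.
have dE : s ^+ 2 - 4 * p = (s - 4) ^+ 2 - 4 * (4 - 2 * s + p) by ring.
have dgt : (s - 4) ^+ 2 < s ^+ 2 - 4 * p by rewrite dE; lra.
have d0 : 0 <= s ^+ 2 - 4 * p by apply: ltW; apply: le_lt_trans dgt; exact: sqr_ge0.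
have qs := sqr_sqrtr d0.
have qgt : `|s - 4| < Num.sqrt (s ^+ 2 - 4 * p).
  by rewrite -sqrtr_sqr ltr_sqrt // (le_lt_trans _ dgt) // sqr_ge0.
have s0 : 0 <= s by rewrite /s mulr_ge0 ?ler0n //; lra.
have sq := ler_norm (s - 4).
set d := Num.sqrt _ in qs qgt.
have dge0 : 0 <= d by exact: sqrtr_ge0.
exists ((s + d) / 2), ((s - d) / 2); split; [by rewrite -/s; field| |lra|lra].
rewrite -/p (_ : _ * _ = (s ^+ 2 - d ^+ 2) / 4); last by field.
by rewrite qs; field.
Qed.

(** Grouped into two terms that are separately nonpositive for the graphs in question. *)
Definition row_sum_defect (G : sgraph) (v : G) : R :=
  (2 * alpha - 1) * (((degree v)%:R - 2) * ((degree v)%:R - (n%:R - 2))) +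
  (1 - alpha) * ((degree v)%:R ^+ 2 + \sum_(u | adj v u) (degree u)%:R - n%:R * (degree v)%:R).

(* The defect is the row sum at [v] of [(A_alpha - rho)(A_alpha - rho')]. *)
Lemma alpha_action_degree (G : sgraph) (rho rho' : R) (v : G) :
  rho + rho' = alpha * n%:R ->
  rho * rho' = 2 * (n%:R - 2) * (2 * alpha - 1) ->
  alpha_action alpha (fun u => (degree u)%:R - rho') v =
  rho * ((degree v)%:R - rho') + row_sum_defect v.
Proof.
move=> sE pE; rewrite /alpha_action big_split /= sumr_const /row_sum_defect.
have -> : #|[pred u | adj v u]| = degree v by apply: eq_card => u; rewrite inE.
(* After both substitutions the identity is linear in [rho'], and the terms in [rho'] cancel. *)
rewrite [rho * _]mulrBr pE -mulr_natr (_ : rho = alpha * n%:R - rho'); last by rewrite -sE addrK.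
ring.
Qed.

End RowSums.

(** * Sign of the row sums in minimally 2-connected graphs *)

Section MinimallyTwoConnectedRowSums.
Variable G : sgraph.
Hypothesis Gmin : minimally_k_connected 2 G.
Hypothesis G4 : (3 < #|G|)%N.

Lemma degree_le_codegree (u v : G) : adj v u -> (degree u <= #|G| - degree v)%N.
Proof.
move=> vu; rewrite -(cardsC [set y | adj v y]) addKn subset_leq_card //.
apply/subsetP => y; rewrite !inE => uy; apply: contraTN uy => vy.
exact: (min2conn_triangle_free Gmin G4 vu vy).
Qed.

(** A neighbour of [v] has at least two neighbours, none of them adjacent to [v]. *)
Lemma degree_le_subn2 (v : G) : (degree v <= #|G| - 2)%N.
Proof.
have /card_gt0P[u] : (0 < degree v)%N by apply: ltnW; exact: degree_ge2.
rewrite inE => vu; have := degree_le_codegree vu.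
by have := degree_ge2 Gmin G4 u; lia.
Qed.

Lemma neighbour_degree_sum_le (v : G) :
  (\sum_(u | adj v u) degree u <= degree v * (#|G| - degree v))%N.
Proof.
rewrite -sum_nat_const big_mkcond [leqRHS]big_mkcond /=.
apply: leq_sum => u _; rewrite inE; case: ifP => // vu; exact: degree_le_codegree.
Qed.

(** Equality makes each neighbour of [v] adjacent to all of the complement of [N]. Two vertices of
    that complement then have a common neighbour, so they are not adjacent. *)
Lemma neighbour_degree_sum_eq (v : G) :
  (\sum_(u | adj v u) degree u = degree v * (#|G| - degree v))%N ->
  forall x y : G, adj x y = (x \in [set y | adj v y]) (+) (y \in [set y | adj v y]).
Proof.
move=> Seq; set N := [set y | adj v y].
have full u : adj v u -> [set y | adj u y] = ~: N.
  move=> vu; apply/eqP; rewrite eqEcard; apply/andP; split.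
    apply/subsetP => y; rewrite !inE => uy; apply: contraTN uy => vy.
    exact: (min2conn_triangle_free Gmin G4 vu vy).
  rewrite leqNgt; apply/negP => ltu.
  have : (\sum_(w | adj v w) degree w < \sum_(w | adj v w) (#|G| - degree v))%N.
    rewrite (bigD1 u) //= [ltnRHS](bigD1 u) //= -addSn leq_add //.
      by rewrite (leq_trans ltu) // -(cardsC N) addKn.
    by apply: leq_sum => w /andP[vw _]; exact: degree_le_codegree.
  by rewrite Seq sum_nat_const /degree cardsE ltnn.
have adjN x y : adj v x -> adj x y = ~~ adj v y.
  by move=> vx; have := in_set (adj x) y; rewrite full // !inE => ->.
have /card_gt0P[u] : (0 < degree v)%N by apply: ltnW; exact: degree_ge2.
rewrite inE => vu x y; rewrite !inE.
have [vx|vx] := boolP (adj v x); first by rewrite adjN.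
have [vy|vy] := boolP (adj v y); first by rewrite adj_sym adjN // vx.
have ux : adj u x by rewrite adjN.
have uy : adj u y by rewrite adjN.
exact/negbTE/(min2conn_triangle_free Gmin G4 ux uy).
Qed.

Variable R : realType.

Lemma degree_bounds_real (v : G) :
  2 <= (degree v)%:R :> R /\ (degree v)%:R <= (#|G|%:R - 2 : R).
Proof.
split; first by rewrite (ler_nat R 2); exact: degree_ge2.
by rewrite -(@natrB R _ 2) ?ler_nat ?degree_le_subn2 //; lia.
Qed.

Lemma row_sum_defect_parts (v : G) :
  ((degree v)%:R - 2) * ((degree v)%:R - (#|G|%:R - 2)) <= 0 :> R /\
  (degree v)%:R ^+ 2 + \sum_(u | adj v u) (degree u)%:R - #|G|%:R * (degree v)%:R <= 0 :> R.
Proof.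
have [d2 dn] := degree_bounds_real v.
split; first by rewrite mulr_ge0_le0 ?subr_ge0 ?subr_le0.
have := neighbour_degree_sum_le v; rewrite -(ler_nat R) natrM natr_sum natrB ?max_card //.
by lra.
Qed.

Variable alpha : R.
Hypothesis halpha : 2^-1 <= alpha < 1.

Lemma row_sum_defect_le0 (v : G) : row_sum_defect alpha #|G| v <= 0.
Proof.
have /andP[a2 a1] := halpha; have [p1 p2] := row_sum_defect_parts v.
by rewrite /row_sum_defect -[leRHS]addr0 lerD // mulr_ge0_le0 //; lra.
Qed.

(** Both nonpositive terms vanish; as [2 * alpha - 1] may be 0, the information comes from the
    second, where [1 - alpha > 0]. *)
Lemma row_sum_defect_eq0 (v : G) : row_sum_defect alpha #|G| v = 0 ->
  (\sum_(u | adj v u) degree u = degree v * (#|G| - degree v))%N.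
Proof.
have /andP[a2 a1] := halpha; have [p1 p2] := row_sum_defect_parts v.
rewrite /row_sum_defect => F0.
have m1 := mulr_ge0_le0 (_ : 0 <= 2 * alpha - 1) p1.
have m2 : (1 - alpha) * ((degree v)%:R ^+ 2 + \sum_(u | adj v u) (degree u)%:R -
    #|G|%:R * (degree v)%:R) == 0.
  by rewrite eq_le mulr_ge0_le0 ?subr_ge0 ?(ltW a1) //=; have := m1 ltac:(lra); lra.
move: m2; rewrite mulf_eq0 subr_eq0 (gt_eqF a1) /= => /eqP e.
apply/eqP; rewrite -(eqr_nat R) natrM natr_sum natrB ?max_card //; apply/eqP.
by lra.
Qed.

End MinimallyTwoConnectedRowSums.

(** * The extremal graph and the comparison *)

(** A degree [d] is 2 or [n - 2], and all [d] neighbours have degree [n - d], so both terms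
    vanish. *)
Lemma complete_bipartite_row_sum_defect (R : realType) (alpha : R) (n : nat)
    (v : complete_bipartite 2 (n - 2)) : (2 <= n)%N -> row_sum_defect alpha n v = 0.
Proof.
move=> n2; have nE : (n - 2)%N%:R = n%:R - 2 :> R by rewrite natrB.
rewrite /row_sum_defect degree_complete_bipartite.
rewrite big_sumType /=.
under eq_bigr => j _ do rewrite degree_complete_bipartite.
under [X in _ + (_ + X) - _]eq_bigr => j _ do rewrite degree_complete_bipartite.
case: v => i /=; rewrite big_pred0_eq sumr_const card_ord -?(mulr_natr (2 : R) (n - 2)) ?nE; ring.
Qed.

Theorem theorem1p3 (R : realType) (alpha : R) (n : nat) (G : sgraph)
    (hn : (5 <= n)%N) (hG : #|G| = n)
    (hmin : minimally_k_connected 2 G)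
    (halpha : 2^-1 <= alpha < 1) :
  alpha_index alpha G <= alpha_index alpha (complete_bipartite 2 (n - 2)) /\
  (alpha_index alpha G = alpha_index alpha (complete_bipartite 2 (n - 2)) <->
   graph_iso G (complete_bipartite 2 (n - 2))).
Proof.
have /andP[a2 a1] := halpha.
have alpha01 : 0 <= alpha <= 1 by rewrite (ltW a1) andbT; lra.
have G4 : (3 < #|G|)%N by rewrite hG; exact: ltnW.
have [rho [rho' [sE pE rho0 rho'2]]] := quotient_roots hn halpha.
(* With zero defect everywhere, the positive vector [deg - rho'] is an eigenvector for [rho]. *)
have Kindex : alpha_index alpha (complete_bipartite 2 (n - 2)) = rho.
  apply: (alpha_index_eq alpha01 (z := fun u => (degree u)%:R - rho')) => [|v|v].
  - by rewrite card_sum !card_ord.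
  - rewrite subr_gt0 degree_complete_bipartite; apply: (lt_le_trans rho'2).
    by case: v => _; rewrite (ler_nat R 2) //; lia.
  - rewrite (alpha_action_degree _ sE pE) complete_bipartite_row_sum_defect ?addr0 //.
    by lia.
have z0 (v : G) : 0 < (degree v)%:R - rho'.
  by rewrite subr_gt0 (lt_le_trans rho'2) // (ler_nat R 2); exact: degree_ge2.
have zle (v : G) : alpha_action alpha (fun u : G => (degree u)%:R - rho') v <=
    rho * ((degree v)%:R - rho').
  by rewrite (alpha_action_degree _ sE pE) gerDl -hG; exact: row_sum_defect_le0.
split; first by rewrite Kindex; exact: (alpha_index_le alpha01 rho0 z0 zle).
split=> [|iso]; last exact: graph_iso_alpha_index.
rewrite Kindex => idx.
have G0 : (0 < #|G|)%N by apply: leq_ltn_trans G4.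
(* Equal indices give a vertex where [zle] is tight, that is, where the defect is 0. *)
have [v] := alpha_index_eq_witness alpha01 G0 z0 zle idx.
rewrite (alpha_action_degree _ sE pE) -[X in _ = X -> _]addr0 => /addrI; rewrite -hG.
move/(row_sum_defect_eq0 hmin G4 halpha)/(neighbour_degree_sum_eq hmin G4) => bip.
have N2 : (1 < #|[set y | adj v y]|)%N by exact: degree_ge2.
have cN2 : (1 < #|~: [set y | adj v y]|)%N.
  have := degree_le_subn2 hmin G4 v; rewrite /degree.
  by have := cardsC [set y | adj v y]; lia.
have [B [B2 cB Badj]] := complete_bipartite_min2conn hmin N2 cN2 bip.
exact: (complete_bipartite_iso B2 cB Badj).
Qed.
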